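(* Let $d\in\mathbb{N}$, $d\ge 1$. For any $\mathbf{x}\in W(d)$, $$\limsup_{n\to\infty}\frac{e_n(\mathbf{x})}{n^{d+1}\log n}=\infty.$$
   Context: For $\ell\in\mathbb{N}$ let $\Delta^{\ell}=\{(z_1,\dots,z_\ell)\in\mathbb{C}^{\ell}: |z_i|\le 1 \text{ for all } i\}$ be the closed unit polydisk, and for $n\in\mathbb{N}$ let $\mathcal{P}_n(\ell)$ be the vector space of polynomials in $\mathbb{C}[z_1,\dots,z_\ell]$ of (total) degree at most $n$. For $D\subset\mathbb{C}^\ell$ and a polynomial $P$ put $\|P\|_D=\sup\{|P(\mathbf{z})|:\mathbf{z}\in D\}$. For $\mathbf{x}=(x_1,\dots,x_d)\in[-1,1]^d$ put $$K=K(\mathbf{x})=\{(e^{z},e^{x_1z},e^{x_2z},\dots,e^{x_dz}): z\in\mathbb{C},\ |z|\le 1\}\subset\mathbb{C}^{d+1},$$ $$E_n(\mathbf{x})=\sup\{\|P\|_{\Delta^{d+1}}: P\in\mathcal{P}_n(d+1),\ \|P\|_K\le 1\},\qquad e_n(\mathbf{x})=\log E_n(\mathbf{x}).$$ For $x\in\mathbb{R}$, $\langle x\rangle=\min\{|x-k|:k\in\mathbb{Z}\}$ is the distance to the nearest integer, and on $\mathbb{R}^d$, $\|\mathbf{q}\|=\max_{1\le i\le d}|q_i|$. Let $\mathbb{Z}^d_{\ge0}=\{(q_1,\dots,q_d)\in\mathbb{Z}^d:q_1,\dots,q_d\ge0\}$. The set $W(d)$ consists of all $\mathbf{x}=(x_1,\dots,x_d)\in[-1,1]^d$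 such that $\{1,x_1,\dots,x_d\}$ is linearly independent over $\mathbb{Z}$ and $$\limsup_{\|\mathbf{q}\|\to\infty,\ \mathbf{q}\in\mathbb{Z}^d_{\ge0}}\frac{-\log\langle\mathbf{q}\cdot\mathbf{x}\rangle}{\|\mathbf{q}\|^{d+1}\log\|\mathbf{q}\|}=\infty.$$ *)

(* Defs.v *)
From HB Require Import structures.
From mathcomp Require Import all_boot all_order all_algebra.
From mathcomp Require Import complex.
From mathcomp Require Import all_classical all_reals all_analysis.
(* The notations of mpoly clash with those of MathComp-Analysis. *)
From mathcomp Require Import -(notations) mpoly.

Set Implicit Arguments.
Unset Strict Implicit.
Unset Printing Implicit Defensive.

Import Order.TTheory GRing.Theory Num.Theory.
Import numFieldNormedType.Exports.

Local Open Scope classical_set_scope.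
Local Open Scope ring_scope.

Notation normc := ComplexField.Normc.normc.

(* Euler's formula: e^(a + ib) = e^a (cos b + i sin b) *)
Definition cexp (R : realType) (z : R[i]) : R[i] :=
  Complex (expR (complex.Re z) * cos (complex.Im z))
          (expR (complex.Re z) * sin (complex.Im z)).

Definition polydisk (R : realType) (l : nat) : set ('I_l -> R[i]) :=
  [set z | forall i, normc (z i) <= 1].

(* [mmeasure mdeg P] is the total degree of P plus one (and 0 if P = 0). *)
Definition polys (R : realType) (n l : nat) : set (mpoly l R[i]) :=
  [set P | (mmeasure mdeg P <= n.+1)%N].

Definition sup_norm (R : realType) (l : nat) (D : set ('I_l -> R[i]))
    (P : mpoly l R[i]) : \bar R :=
  ereal_sup [set (normc (meval z P))%:E | z in D].

Definition exp_curve (R : realType) (d : nat) (x : 'rV[R]_d) :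
    set ('I_d.+1 -> R[i]) :=
  [set (fun i : 'I_d.+1 =>
          if unlift ord0 i is Some j then cexp (Complex (x ord0 j) 0 * z)
          else cexp z)
     | z in [set z : R[i] | normc z <= 1]].

(* Valued in [\bar R], as the supremum is not a priori finite. *)
Definition E_ (R : realType) (d : nat) (x : 'rV[R]_d) (n : nat) : \bar R :=
  ereal_sup [set sup_norm (@polydisk R d.+1) P
     | P in [set P | @polys R n d.+1 P /\
                     (sup_norm (exp_curve x) P <= 1)%E]].

Definition e_ (R : realType) (d : nat) (x : 'rV[R]_d) (n : nat) : \bar R :=
  lne (E_ x n).

(* The infimum is attained, so it is the minimum. *)
Definition dist_int (R : realType) (t : R) : R :=
  inf [set `|t - k%:~R| | k in [set: int]].

Definition max_norm (d : nat) (q : 'rV[nat]_d) : nat :=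
  (\max_(i < d) q ord0 i)%N.

(* the filter "||q|| --> oo" on the nonnegative integer vectors *)
Definition max_norm_infty (d : nat) : set_system 'rV[nat]_d :=
  filter_from [set: nat] (fun N => [set q | (N <= max_norm q)%N]).

Definition lin_indep_int (R : realType) (d : nat) (x : 'rV[R]_d) : Prop :=
  forall (a0 : int) (a : 'I_d -> int),
    a0%:~R + \sum_(i < d) (a i)%:~R * x ord0 i = 0 ->
    a0 = 0 /\ forall i, a i = 0.

Definition W (R : realType) (d : nat) : set 'rV[R]_d :=
  [set x : 'rV[R]_d |
    [/\ forall i, -1 <= x ord0 i <= 1,
        lin_indep_int x &
        limf_esup
          (fun q : 'rV[nat]_d =>
             ((- ln (dist_int (\sum_(i < d) (q ord0 i)%:R * x ord0 i))) /
              ((max_norm q)%:R ^+ d.+1 * ln (max_norm q)%:R))%:E)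
          (@max_norm_infty d) = +oo%E]].

(* Main.v *)
Require Import Defs.
From mathcomp Require Import all_boot all_order all_algebra.
From mathcomp Require Import complex.
From mathcomp Require Import all_classical all_reals all_analysis.
(* The notations of mpoly clash with those of MathComp-Analysis. *)
From mathcomp Require Import -(notations) mpoly.
From mathcomp Require Import ring lra zify.

Set Implicit Arguments.
Unset Strict Implicit.
Unset Printing Implicit Defensive.

Import Order.TTheory GRing.Theory Num.Theory.
Import numFieldNormedType.Exports.
Import ComplexField.Normc.

Local Open Scope classical_set_scope.
Local Open Scope ring_scope.

(** The idea is that a good rational relation between 1, x_1, ..., x_d yields
    a polynomial that almost vanishes on the curve K.  Suppose that
    a = q.x lies within eps <= 1 of an integer k, with q a nonzero vector of
    natural numbers, and write k = k1 - k2 with k1 and k2 natural numbers, one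
    of them 0.  At the point (e^z, e^(x_1 z), ..., e^(x_d z)) of K the binomial

      X_0^k2 X_1^q_1 ... X_d^q_d - X_0^k1

    takes the value e^((k2 + a) z) - e^(k1 z) = e^(k1 z) (e^((a - k) z) - 1),
    which for |z| <= 1 has modulus at most 2 eps e^(eps + k1)
    ([binomial_poly_curve]).  On the other hand its modulus is 1 at a point of
    the polydisk with coordinates 0 and 1 ([binomial_poly_polydisk]).  Hence

      e_n(x) >= - log eps - n - 2

    as soon as n bounds the degree of the binomial ([ge_e_near_resonance]).

    When <q.x> <= 1/2, choose k at distance less than eps = 2 <q.x> from q.x.
    Since |x_i| <= 1, it satisfies |k| <= q_1 + ... + q_d + 1, so the degree
    n = 3 d m suffices, where m = ||q|| ([ge_e_dist_int]).  As d is fixed,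
    n^(d+1) log n is comparable to m^(d+1) log m, and the loss log 2 + n + 2 is
    of lower order ([growth_comparison]).
    So when - log <q.x> exceeds every multiple of ||q||^(d+1) log ||q||
    along a sequence of vectors q, e_n exceeds every multiple of
    n^(d+1) log n along the corresponding degrees n = 3 d ||q||. *)

(** * The complex exponential near the origin *)

Section ComplexExponential.
Variable R : realType.
Implicit Types (u v : R) (z w : R[i]).

Lemma cexp0 : cexp (0 : R[i]) = 1.
Proof. by rewrite /cexp /= expR0 cos0 sin0 mulr1 mulr0. Qed.

Lemma cexpD : {morph @cexp R : z w / z + w >-> z * w}.
Proof.
move=> [a b] [c d]; rewrite /cexp /= expRD cosD sinD.
by apply/eqP; rewrite eq_complex /=; apply/andP; split; apply/eqP; ring.
Qed.

Lemma cexp_sum (I : Type) (r : seq I) (P : pred I) (F : I -> R[i]) :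
  cexp (\sum_(i <- r | P i) F i) = \prod_(i <- r | P i) cexp (F i).
Proof. exact: (big_morph _ cexpD cexp0). Qed.

Lemma cexpMn z n : cexp (z *+ n) = cexp z ^+ n.
Proof.
by elim: n => [|n IHn]; rewrite ?mulr0n ?cexp0// mulrS cexpD IHn exprS.
Qed.

Lemma normc_cexp z : normc (cexp z) = expR (complex.Re z).
Proof.
case: z => a b; rewrite /cexp /= !exprMn -mulrDr cos2Dsin2 mulr1.
by rewrite sqrtr_sqr ger0_norm// expR_ge0.
Qed.

Lemma normr_Re_le z : `|complex.Re z| <= normc z.
Proof.
by case: z => a b; rewrite /= -sqrtr_sqr ler_wsqrtr// lerDl sqr_ge0.
Qed.

Lemma normr_Im_le z : `|complex.Im z| <= normc z.
Proof.
by case: z => a b; rewrite /= -sqrtr_sqr ler_wsqrtr// lerDr sqr_ge0.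
Qed.

(** For u < 0 the bound comes from 1 - e^u <= - u, and for u >= 0 from
    e^u - 1 = e^u (1 - e^(-u)) <= u e^u: both are the tangent line inequality
    1 + t <= e^t. *)
Lemma normr_expRB1 u : `|expR u - 1| <= `|u| * expR `|u|.
Proof.
have h1 := expR_ge1Dx u; have h2 := expR_ge1Dx (- u).
have e0 := expR_gt0 u; have e1 : expR u * expR (- u) = 1.
  by rewrite -expRD subrr expR0.
have [u0|u0] := lerP 0 u.
  rewrite (ger0_norm u0) ger0_norm; last by lra.
  by nra.
have e2 : 1 <= expR (- u) by lra.
rewrite (ltr0_norm u0) ler0_norm; last by nra.
by nra.
Qed.

Lemma normr_sin_le v : `|sin v| <= `|v|.
Proof.
wlog v0 : v / 0 <= v => [hw|].
  have [/hw//|/ltW v0] := lerP 0 v.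
  by rewrite -normrN -sinN -(normrN v) hw// oppr_ge0.
have [c _] := @MVT_segment R (@sin R) (@cos R) 0 v v0
  (fun x _ => is_derive_sin x) (continuous_subspaceT (@continuous_sin R)).
rewrite sin0 !subr0 => ->.
by rewrite normrM ler_piMl// cos_max.
Qed.

(** A chord of the unit circle is shorter than its arc: the squared length is
    2 (1 - cos v) = (2 sin (v / 2))^2. *)
Lemma normc_cexpiB1 v : normc (cexp (Complex 0 v) - 1) <= `|v|.
Proof.
rewrite /cexp /= expR0 !mul1r -(sqrtr_sqr v) ler_wsqrtr//.
have -> : (cos v + -1) ^+ 2 + (sin v + - 0) ^+ 2 = 2 * (1 - cos v).
  by have := cos2Dsin2 v; nra.
have := normr_sin_le (v / 2); rewrite -ler_sqr ?nnegrE// !real_normK ?num_real//.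
have -> : cos v = 1 - 2 * sin (v / 2) ^+ 2.
  by rewrite [in LHS](splitr v) cosD; have := cos2Dsin2 (v / 2); nra.
nra.
Qed.

(** With w = u + iv, split e^w - 1 = e^(iv) (e^u - 1) + (e^(iv) - 1) into a
    radial and an angular displacement, each at most |w| e^|w|. *)
Lemma normc_cexpB1 w : normc (cexp w - 1) <= 2 * normc w * expR (normc w).
Proof.
have hRe := normr_Re_le w; have hIm := normr_Im_le w.
have eRe : expR `|complex.Re w| <= expR (normc w) by rewrite ler_expR.
have e1 : 1 <= expR (normc w) by rewrite -expR0 ler_expR (le_trans _ hRe).
set u := complex.Re w in hRe eRe *; set v := complex.Im w in hIm *.
have -> : cexp w - 1 = cexp (Complex 0 v) * Complex (expR u - 1) 0
                       + (cexp (Complex 0 v) - 1).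
  apply/eqP; rewrite /u /v; case: (w) => a b; rewrite /cexp eq_complex /= expR0.
  by apply/andP; split; apply/eqP; ring.
apply: (le_trans (@le_normcD R _ _)).
rewrite normcM normc_cexp expR0 mul1r.
have -> : normc (Complex (expR u - 1) 0) = `|expR u - 1|.
  by rewrite /= expr0n addr0 sqrtr_sqr.
have hb := normc_cexpiB1 v; have ha := normr_expRB1 u.
have n0 := normr_ge0 u; have m0 := normr_ge0 v.
apply: (@le_trans _ _ (normc w * expR (normc w) + normc w * expR (normc w))).
  apply: lerD; first exact: le_trans ha (ler_pM _ _ _ _).
  apply: le_trans (le_trans hb hIm) _.
  by rewrite ler_peMr// (le_trans _ hRe).
by rewrite -mulrDl -mulr2n -[normc w *+ 2]mulr_natl.
Qed.

End ComplexExponential.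

(** * Binomials that are small on the curve *)

Section ExtremalFunction.
Variables (R : realType) (d : nat).
Implicit Types (x : 'rV[R]_d) (q : 'rV[nat]_d).

(** Rescaled by 1 / c, a polynomial that is at most c on the curve and reaches
    1 on the polydisk competes in the supremum defining E_n with the value
    1 / c. *)
Lemma ge_e_polys x n (P : mpoly d.+1 R[i]) (c : R) (w : 'I_d.+1 -> R[i]) :
  0 < c -> polys n P -> polydisk w -> 1 <= normc (meval w P) ->
  (forall z, exp_curve x z -> normc (meval z P) <= c) ->
  ((- ln c)%:E <= e_ x n)%E.
Proof.
move=> c0 Pn wD wP Pc.
pose Q := mpoly_scale (Complex c^-1 0) P.
have normQ z : normc (meval z Q) = c^-1 * normc (meval z P).
  rewrite mevalZ normcM; congr *%R.
  by rewrite /= expr0n addr0 sqrtr_sqr ger0_norm// invr_ge0 ltW.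
have : ((c^-1)%:E <= E_ x n)%E.
  apply: (@le_trans _ _ (sup_norm (@polydisk R d.+1) Q)).
    apply: le_ereal_sup_tmp; exists (normc (meval w Q))%:E; first by exists w.
    by rewrite lee_fin normQ ler_peMr// invr_ge0 ltW.
  apply: ereal_sup_ubound; exists Q => //; split.
    exact: leq_trans (mmeasureZ_le _ _ _) Pn.
  apply: ge_ereal_sup => _ [z Kz <-].
  by rewrite lee_fin normQ mulrC ler_pdivrMr// mul1r Pc.
have c'0 : 0 < c^-1 by rewrite invr_gt0.
move=> cE; rewrite -lnV ?posrE// -lne_EFin// /e_ lee_lne//.
  by rewrite in_itv /= lee_fin ltW//= leey.
by rewrite in_itv /= leey andbT (le_trans _ cE)// lee_fin ltW.
Qed.

Definition frequency x q : R := \sum_(j < d) (q ord0 j)%:R * x ord0 j.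

(** The exponent of the monomial X_0^k X_1^q_1 ... X_d^q_d. *)
Definition mnm_cons (k : nat) q : multinom d.+1 :=
  Multinom (mktuple
    (fun i : 'I_d.+1 => if unlift ord0 i is Some j then q ord0 j else k)).

Lemma mdeg_mnm_cons k q : mdeg (mnm_cons k q) = (k + \sum_j q ord0 j)%N.
Proof.
rewrite mdegE big_ord_recl multinomE tnth_mktuple unlift_none; congr addn.
by apply: eq_bigr => j _; rewrite multinomE tnth_mktuple liftK.
Qed.

Lemma meval_mnm_cons (w : 'I_d.+1 -> R[i]) k q :
  meval w (mpolyX R[i] (mnm_cons k q)) =
  w ord0 ^+ k * \prod_j w (lift ord0 j) ^+ q ord0 j.
Proof.
rewrite mevalX big_ord_recl multinomE tnth_mktuple unlift_none; congr *%R.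
by apply: eq_bigr => j _; rewrite multinomE tnth_mktuple liftK.
Qed.

(** Monomials restrict to pure exponentials on the curve, which is what turns
    an integer relation between 1 and the x_j into a polynomial relation. *)
Lemma meval_curve_mnm_cons x k q (z : R[i]) :
  meval (fun i : 'I_d.+1 =>
      if unlift ord0 i is Some j then cexp (Complex (x ord0 j) 0 * z)
      else cexp z) (mpolyX R[i] (mnm_cons k q)) =
  cexp (Complex (k%:R + frequency x q) 0 * z).
Proof.
rewrite meval_mnm_cons unlift_none -cexpMn.
under eq_bigr do rewrite liftK -cexpMn.
rewrite -cexp_sum -cexpD; congr cexp.
rewrite -[Complex _ 0]/((k%:R + frequency x q)%:C)%C rmorphD rmorph_nat mulrDl mulr_natl.
congr +%R; rewrite /frequency rmorph_sum mulr_suml; apply: eq_bigr => j _.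
by rewrite rmorphM rmorph_nat -mulrA mulr_natl.
Qed.

Definition binomial_poly (k1 k2 : nat) q : mpoly d.+1 R[i] :=
  mpolyX R[i] (mnm_cons k2 q) - mpolyX R[i] (mnm_cons k1 0).

Lemma polys_binomial_poly n k1 k2 q :
  (k1 + k2 + \sum_j q ord0 j <= n)%N -> polys n (binomial_poly k1 k2 q).
Proof.
move=> hn; rewrite /polys /=.
apply: leq_trans (mmeasureD_le _ _ _) _.
rewrite mmeasureN !mmeasureX geq_max !ltnS /= !mdeg_mnm_cons.
rewrite [X in (k1 + X)%N]big1 => [|j _]; last by rewrite mxE.
by lia.
Qed.

(** If k1 = 0 the binomial is -1 at the origin, where the monomial of a nonzero
    q vanishes; otherwise k2 = 0 and it is 1 at (0, 1, ..., 1). *)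
Lemma binomial_poly_polydisk k1 k2 q :
  (k1 == 0)%N || (k2 == 0)%N -> q != 0 ->
  exists2 w, polydisk w & normc (meval w (binomial_poly k1 k2 q)) = 1.
Proof.
move=> k12 q0; rewrite /binomial_poly.
have [k10|k10] := eqVneq k1 0%N.
  exists (fun=> 0) => [i|]; first by rewrite normc0.
  rewrite mevalB !meval_mnm_cons k10 expr0 mul1r.
  have [j qj] : exists j, q ord0 j != 0%N.
    apply/existsP; apply: contraNT q0; rewrite negb_exists => /forallP q0.
    by apply/eqP/rowP => j; rewrite mxE; apply/eqP; move: (q0 j); rewrite negbK.
  rewrite (bigD1 j)//= [_ ^+ q _ _]expr0n (negPf qj) mul0r mulr0.
  rewrite [X in _ - X]big1 => [|i _]; last by rewrite mxE.
  by rewrite sub0r (@normcN R) normc1.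
move: k12; rewrite (negPf k10) /= => /eqP ->.
exists (fun i => if unlift ord0 i is Some _ then 1 else 0) => [i|].
  by case: unlift => *; rewrite ?normc0 ?normc1.
rewrite mevalB !meval_mnm_cons unlift_none expr0 mul1r expr0n (negPf k10) mul0r.
by rewrite subr0 big1 ?normc1// => j _; rewrite liftK expr1n.
Qed.

(** The value is e^(k1 z) (e^(t z) - 1) with t = q.x - (k1 - k2), and |t| is at
    most eps. *)
Lemma binomial_poly_curve x q k1 k2 (eps : R) (z : 'I_d.+1 -> R[i]) :
  `|frequency x q - (k1%:R - k2%:R)| <= eps -> exp_curve x z ->
  normc (meval z (binomial_poly k1 k2 q)) <= 2 * eps * expR (eps + k1%:R).
Proof.
set t := frequency x q - _ => t_eps [s /= s1 <-].
rewrite /binomial_poly mevalB !meval_curve_mnm_cons.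
have -> : frequency x 0 = 0 by rewrite /frequency big1// => j _; rewrite mxE mul0r.
rewrite addr0.
have -> : Complex (k2%:R + frequency x q) 0 * s = s *+ k1 + Complex t 0 * s.
  rewrite -[s *+ k1]mulr_natl -mulrDl -(rmorph_nat (real_complex R)) -[Complex t 0]/(t%:C)%C.
  rewrite -rmorphD /=; congr (Complex _ 0 * s).
  by rewrite /t; ring.
have -> : Complex k1%:R 0 * s = s *+ k1.
  by rewrite -[Complex _ 0]/((k1%:R)%:C)%C rmorph_nat mulr_natl.
rewrite cexpD -[X in _ - X]mulr1 -mulrBr normcM normc_cexp.
have eps0 : 0 <= eps by exact: le_trans (normr_ge0 _) t_eps.
have ts : normc (Complex t 0 * s) <= eps.
  rewrite normcM /= expr0n addr0 sqrtr_sqr -[eps]mulr1.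
  by rewrite ler_pM// (le_trans _ (normr_Re_le s)).
have ns : 0 <= normc (Complex t 0 * s) by rewrite (le_trans _ (normr_Re_le _)).
have Re_s : complex.Re (s *+ k1) <= k1%:R.
  have -> : complex.Re (s *+ k1) = complex.Re s *+ k1.
    by elim: (k1) => // n IHn; rewrite !mulrS -IHn; case: (s) (s *+ n) => ? ? [].
  rewrite ler_wMn2r// (le_trans (ler_norm _))//.
  exact: le_trans (normr_Re_le s) s1.
have K1 : expR (complex.Re (s *+ k1)) <= expR k1%:R by rewrite ler_expR.
have K2 := normc_cexpB1 (Complex t 0 * s).
apply: le_trans (ler_pM (expR_ge0 _) _ K1 K2) _.
  exact: le_trans (normr_ge0 _) (normr_Re_le _).
rewrite expRD [leLHS]mulrC [leRHS]mulrA ler_wpM2r ?expR_ge0//.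
by rewrite ler_pM ?mulr_ge0 ?expR_ge0 ?ler_pM ?ler_expR.
Qed.

(** The bound 2 eps e^(eps + k1) of the binomial on the curve is at most
    eps e^(n + 2), because 2 <= e, eps <= 1 and k1 <= n. *)
Lemma ge_e_near_resonance x q k1 k2 n (eps : R) :
  0 < eps <= 1 -> `|frequency x q - (k1%:R - k2%:R)| <= eps ->
  (k1 == 0)%N || (k2 == 0)%N -> q != 0 ->
  (k1 + k2 + \sum_j q ord0 j <= n)%N ->
  ((- ln eps - n%:R - 2)%:E <= e_ x n)%E.
Proof.
move=> /andP[eps0 eps1] x_eps k12 q0 deg_n.
have [w wD w1] := binomial_poly_polydisk k12 q0.
pose c := expR (ln eps + n%:R + 2).
have c0 : 0 < c by exact: expR_gt0.
have -> : - ln eps - n%:R - 2 = - ln c by rewrite expRK !opprD.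
apply: (@ge_e_polys x n (binomial_poly k1 k2 q) c w c0) => //.
- exact: polys_binomial_poly.
- by rewrite w1.
move=> z Kz; apply: le_trans (binomial_poly_curve x_eps Kz) _.
rewrite /c -addrA [leRHS]expRD lnK ?posrE// [2 * eps]mulrC -mulrA (ler_wpM2l (ltW eps0))//.
rewrite (_ : n%:R + 2 = 1 + (1 + n%:R)); last by ring.
rewrite [leRHS]expRD ler_pM ?expR_ge0 ?ler_expR ?lerD// ?ler_nat; last by lia.
by rewrite (le_trans _ (expR_ge1Dx 1))//; lra.
Qed.

End ExtremalFunction.

(** * Integers close to q.x *)

Lemma frequency_norm_le (R : realType) (d : nat) (x : 'rV[R]_d) (q : 'rV[nat]_d) :
  (forall i, -1 <= x ord0 i <= 1) ->
  `|frequency x q| <= (\sum_j q ord0 j)%:R.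
Proof.
move=> hx; apply: le_trans (ler_norm_sum _ _ _) _; rewrite natr_sum.
by apply: ler_sum => j _; rewrite normrM normr_nat ler_piMr// ler_norml.
Qed.

Lemma sum_le_max_norm (d : nat) (q : 'rV[nat]_d) :
  (\sum_j q ord0 j <= d * max_norm q)%N.
Proof.
apply: (@leq_trans (\sum_(j < d) max_norm q)%N).
  by apply: leq_sum => j _; exact: (leq_bigmax j).
by rewrite sum_nat_const card_ord.
Qed.

Lemma dist_int_lt (R : realType) (t : R) (eps : R) :
  dist_int t < eps -> exists k : int, `|t - k%:~R| < eps.
Proof.
rewrite -subr_gt0 => t_eps.
have [|_ [k _ <-]] := inf_adherent t_eps
    (_ : has_inf [set `|t - k%:~R| | k in [set: int]]).
  by split; [exists `|t - 0%:~R|; exists 0|exists 0 => _ [k _ <-]].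
by rewrite -/(dist_int t) [ltRHS]addrC subrK; exists k.
Qed.

Lemma dist_int_ge0 (R : realType) (t : R) : 0 <= dist_int t.
Proof.
apply: lb_le_inf; first by exists `|t - 0%:~R|; exists 0.
by move=> _ [k _ <-].
Qed.

(** The factor 2 leaves room to pick an integer from the definition of the
    distance as an infimum, without knowing that it is attained. The integer is
    at most d ||q|| + 1 in modulus, so the binomial has degree at most
    2 d ||q|| + 1 <= 3 d ||q||. *)
Lemma ge_e_dist_int (R : realType) (d : nat) (x : 'rV[R]_d) (q : 'rV[nat]_d) :
  (0 < d)%N -> (forall i, -1 <= x ord0 i <= 1) -> q != 0 ->
  0 < dist_int (frequency x q) <= 2^-1 ->
  ((- ln (2 * dist_int (frequency x q)) - (3 * d * max_norm q)%:R - 2)%:E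
     <= e_ x (3 * d * max_norm q))%E.
Proof.
move=> d0 hx q0 /andP[del0 del1]; set a := frequency x q in del0 del1 *.
have [|k ak] := @dist_int_lt R a (2 * dist_int a); first by lra.
have m0 : (0 < max_norm q)%N.
  rewrite lt0n; apply: contraNneq q0 => m0; apply/eqP/rowP => j; rewrite mxE.
  by apply/eqP; rewrite -leqn0 (leq_trans (leq_bigmax j))// -/(max_norm q) m0.
have hk : (`|k| <= (\sum_j q ord0 j).+1)%N.
  have hka : `|k%:~R| <= (\sum_j q ord0 j).+1%:R :> R.
    rewrite -natr1 -[_%:~R](subrK a) (le_trans (ler_normD _ _))//.
    rewrite addrC lerD ?frequency_norm_le// distrC.
    by rewrite (le_trans (ltW ak))//; lra.
  by move: hka; rewrite -intr_norm pmulrn ler_int; lia.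
have hS := sum_le_max_norm q.
have hdm : (0 < d * max_norm q)%N by rewrite muln_gt0 d0.
have eps1 : 0 < 2 * dist_int a <= 1 by apply/andP; split; lra.
case: k ak hk => k ak hk.
  apply: (@ge_e_near_resonance R d x q k 0 _ _ eps1) => //.
  - by rewrite subr0 ltW.
  - by rewrite orbT.
  - by move: hk; rewrite absz_nat -mulnA; lia.
apply: (@ge_e_near_resonance R d x q 0 k.+1 _ _ eps1) => //.
- by rewrite sub0r; move: ak; rewrite NegzE mulrNz => /ltW.
- by move: hk; rewrite -mulnA; lia.
Qed.

(** * Comparison of the two upper limits *)

Lemma limf_esup_eqyP (T : choiceType) (X : filteredType T) (R : realType)
    (f : X -> \bar R) (F : set_system X) :
  limf_esup f F = +oo%E <->
  forall V (A : R), F V -> exists2 t, V t & (A%:E < f t)%E.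
Proof.
rewrite limf_esupE ereal_inf_pinfty; split => [h V A FV|h _ [V FV <-]].
  have : (A%:E < ereal_sup (f @` V))%E.
    by rewrite (h (ereal_sup (f @` V))) ?ltry//; exists V.
  by move/ereal_sup_gt => [_ [t Vt <-] At]; exists t.
apply: eq_infty => A; have [t Vt At] := h V A FV.
by apply: le_ereal_sup_tmp; exists (f t); [exists t|exact: ltW].
Qed.

Lemma ln2_le1 (R : realType) : ln 2 <= 1 :> R.
Proof. by rewrite -ler_expR lnK ?posrE//; have := expR_ge1Dx (1 : R); lra. Qed.

(** Put D = 3 d and n = D m. As D <= m, log n <= 2 log m, so
    A n^(d+1) log n <= 2 A D^(d+1) m^(d+1) log m; as m >= e, the loss
    log 2 + n + 2 is at most (D + 3) m^(d+1) log m. *)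
Lemma growth_comparison (R : realType) (d m : nat) (A L : R) :
  (0 < d)%N -> 0 < A -> (3 * d <= m)%N -> expR 1 <= m%:R :> R ->
  (2 * A * (3 * d)%:R ^+ d.+1 + (3 * d + 3)%:R) * (m%:R ^+ d.+1 * ln m%:R) < L ->
  A * ((3 * d * m)%:R ^+ d.+1 * ln (3 * d * m)%:R) <
    L - ln 2 - (3 * d * m)%:R - 2.
Proof.
move=> d0 A0 dm em.
have m0 : 0 < m%:R :> R by rewrite (lt_le_trans _ em) ?expR_gt0.
have D0 : 0 < (3 * d)%:R :> R by rewrite ltr0n muln_gt0.
have lnm : 1 <= ln m%:R :> R by rewrite -ler_expR lnK.
have ln2 := ln2_le1 R.
have lnDm : ln (3 * d)%:R <= ln m%:R :> R by rewrite ler_ln ?posrE ?ler_nat.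
rewrite (natrM _ (3 * d)%N m) exprMn lnM ?posrE// natrD.
set D := (3 * d)%:R in D0 lnDm *; set l := ln m%:R in lnm lnDm *.
have m1 : 1 <= m%:R :> R by rewrite ler1n -(ltr0n R).
have mp : m%:R <= m%:R ^+ d.+1 :> R by rewrite exprS ler_peMr ?exprn_ege1// ltW.
have Mp0 : 0 < m%:R ^+ d.+1 :> R by rewrite exprn_gt0.
have Dp0 : 0 < D ^+ d.+1 by rewrite exprn_gt0.
set M := m%:R ^+ d.+1 in mp Mp0 *; set Dp := D ^+ d.+1 in Dp0 *.
move=> hL.
have lin : D * m%:R + 3 <= (D + 3) * (M * l).
  have Ml : M <= M * l by rewrite ler_peMr// ltW.
  by nra.
have main : A * (Dp * M * (ln D + l)) <= 2 * A * Dp * (M * l).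
  have : 0 <= A * (Dp * M) by rewrite !mulr_ge0// ltW.
  by nra.
by nra.
Qed.

Theorem theorem1p3 (R : realType) (d : nat) (hd : (1 <= d)%N) (x : 'rV[R]_d)
    (hx : W x) :
  limn_esup (fun n : nat =>
    (e_ x n * ((n%:R ^+ d.+1 * ln n%:R)^-1)%:E)%E) = +oo%E.
Proof.
case: hx => x1 _ /limf_esup_eqyP Hx.
apply/limf_esup_eqyP => V A0 [N _ NV].
(* The target A0 may be negative; a positive one makes B >= 1. *)
pose A := Num.max A0 1.
have A_gt0 : 0 < A by rewrite lt_max ltr01 orbT.
pose B := 2 * A * (3 * d)%:R ^+ d.+1 + (3 * d + 3)%:R.
have B1 : 1 <= B.
  apply: (@le_trans _ _ (3 * d + 3)%:R); first by rewrite ler1n; lia.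
  by rewrite lerDr !mulr_ge0// ltW.
pose N' := maxn N (maxn (3 * d) (Num.truncn (expR 1 : R)).+1).
have [|q /= qN'] := Hx [set q | (N' <= max_norm q)%N] B.
  by exists N'.
rewrite lte_fin -/(frequency x q); set m := max_norm q in qN' *.
have [mN md mt] : [/\ (N <= m)%N, (3 * d <= m)%N & expR 1 <= m%:R :> R].
  move: qN'; rewrite /N' !geq_max => /and3P[-> -> tm]; split => //.
  apply: ltW; apply: lt_le_trans (truncnS_gt _) _.
  by rewrite ler_nat.
have m3 : (3 <= m)%N by apply: leq_trans md; rewrite -{1}[3%N]muln1 leq_mul2l.
have n1 : (1 < 3 * d * m)%N by rewrite -mulnA mulnCA; nia.
have lnm : 1 <= ln m%:R :> R by rewrite -ler_expR lnK// posrE ltr0n; lia.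
have m1 : 1 <= m%:R ^+ d.+1 :> R by rewrite exprn_ege1// ler1n; lia.
have ml1 : 1 <= m%:R ^+ d.+1 * ln m%:R :> R by rewrite mulr_ege1.
rewrite ltr_pdivlMr; last exact: lt_le_trans ml1.
set delta := dist_int _ => hdelta.
have lnd : ln delta < -1 by nra.
(* ln 0 = 0, so a vector with q.x an integer cannot have a large quotient. *)
have delta0 : 0 < delta.
  rewrite lt0r dist_int_ge0 andbT; apply: contraTneq lnd => ->.
  by rewrite ln0// -leNgt oppr_le0.
have delta1 : delta <= 2^-1.
  rewrite -ler_ln ?posrE ?invr_gt0// lnV ?posrE//.
  by have := ln2_le1 R; lra.
have q0 : q != 0.
  apply: contraTneq m3 => q0; rewrite -ltnNge /m /max_norm big1// => i _.
  by rewrite q0 mxE.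
have dd : 0 < delta <= 2^-1 by rewrite delta0.
have he := ge_e_dist_int hd x1 q0 dd.
exists (3 * d * m)%N.
  by apply: NV => /=; apply: leq_trans mN _; rewrite leq_pmull// muln_gt0.
have hg := growth_comparison hd A_gt0 md mt hdelta.
apply: (@le_lt_trans _ _ A%:E); first by rewrite lee_fin le_max lexx.
have den0 : 0 < (3 * d * m)%:R ^+ d.+1 * ln (3 * d * m)%:R :> R.
  by rewrite mulr_gt0 ?exprn_gt0 ?ln_gt0 ?ltr0n ?ltr1n// ltnW.
rewrite lte_pdivlMr//; apply: lt_le_trans he.
rewrite -EFinM lte_fin lnM ?posrE// opprD.
by move: hg; rewrite [- ln delta - ln 2]addrC.
Qed.
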